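(* Let $G$ be an undirected graph, regarded as a symmetric digraph, and let $k \geq 1$ be an integer. Then $$\chi(\delta^k(G)) = \min\{ n \mid \chi(G) \leq b(n,k) \}.$$
   Context: A digraph has a set of vertices and a set of arcs (ordered pairs of vertices). An undirected graph is regarded as a symmetric digraph, each edge $\{u,v\}$ corresponding to the two arcs $(u,v)$ and $(v,u)$. The arc graph $\delta(G)$ of a digraph $G$ is the digraph whose vertex set is the arc set $A(G)$ of $G$, with an arc from $(u,v)$ to $(v,w)$ whenever both are arcs of $G$ (i.e., arcs of $\delta(G)$ join consecutive arcs of $G$). Iterated arc graphs are defined by $\delta^1(G)=\delta(G)$ and $\delta^k(G)=\delta(\delta^{k-1}(G))$. The chromatic number $\chi$ of a digraph is the minimum number of colours needed to colour its vertices so that the two endpoints of every arc receive different colours (direction of arcs is irrelevant). For a poset $P$, $\mathcal{I}(P)$ denotes the poset of all ideals (downsets, including the empty set) of $P$, ordered by inclusion; $\mathcal{I}^k$ denotes the $k$-fold iteration. $\overline{K}_n$ denotes the antichain with $n$ elements. $b(n,k)$ denotes the width (maximum size of an antichain) of $\mathcal{I}^k(\overline{K}_n)$. *)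

(* Defs.v *)
From HB Require Import structures.
From mathcomp Require Import all_boot all_order.
From mathcomp Require Import boolp.

Set Implicit Arguments.
Unset Strict Implicit.
Unset Printing Implicit Defensive.

(* [None] encodes the minimum of the empty set, i.e. "no finite value". *)
Definition min_nat (P : nat -> Prop) : option nat :=
  if pselect (exists n, `[< P n >]) is left exP then Some (ex_minn exP)
  else None.

Definition onat_le (x : option nat) (n : nat) : bool :=
  if x is Some m then m <= n else false.

Record digraph := Digraph { vertex :> Type; is_arc : rel vertex }.

Definition arc_graph (G : digraph) : digraph :=
  @Digraph {e : G * G | is_arc e.1 e.2}
    (fun e f => `[< (sval e).2 = (sval f).1 >]).

Definition colorable (G : digraph) (n : nat) : Prop :=
  exists c : G -> 'I_n, forall u v : G, is_arc u v -> c u <> c v.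

(* [None] when no finite number of colours suffices (infinite chromatic number
   or a loop). *)
Definition chromatic_number (G : digraph) : option nat :=
  min_nat (colorable G).

Section Ideals.
Context {d : Order.disp_t} (P : finPOrderType d).

Definition is_ideal (A : {set P}) : bool :=
  [forall x in A, forall y : P, (y <= x)%O ==> (y \in A)].

Record ideal := Ideal { ideal_set :> {set P}; _ : is_ideal ideal_set }.

HB.instance Definition _ := [isSub for ideal_set].
HB.instance Definition _ := [Finite of ideal by <:].

Definition ideal_le (A B : ideal) : bool := ideal_set A \subset ideal_set B.

Fact ideal_le_refl : reflexive ideal_le.
Proof. by move=> A; exact: subxx. Qed.

Fact ideal_le_anti : antisymmetric ideal_le.
Proof. by move=> A B; rewrite /ideal_le -eqEsubset => /eqP /val_inj. Qed.

Fact ideal_le_trans : transitive ideal_le.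
Proof. by move=> B A C; exact: subset_trans. Qed.

HB.instance Definition _ := Order.Le_isPOrder.Build d ideal
  ideal_le_refl ideal_le_anti ideal_le_trans.

Definition ideal_poset : finPOrderType d := ideal.

Definition antichain (A : {set P}) : bool :=
  [forall x in A, forall y in A, (x <= y)%O ==> (x == y)].

Definition width : nat := \max_(A : {set P} | antichain A) #|A|.

End Ideals.

(* An alias of ['I_n], so that the equality order does not clash with the
   library's linear order on ['I_n]. *)
Definition discrete (n : nat) : Type := 'I_n.

Section Discrete.
Variable n : nat.

HB.instance Definition _ := Finite.on (discrete n).

Fact discrete_le_anti : antisymmetric (@eq_op (discrete n)).
Proof. by move=> x y /andP[/eqP]. Qed.

Fact discrete_le_trans : transitive (@eq_op (discrete n)).
Proof. by move=> y x z /eqP ->. Qed.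

HB.instance Definition _ := Order.Le_isPOrder.Build (Order.Disp tt tt)
  (discrete n) (@eqxx _) discrete_le_anti discrete_le_trans.

End Discrete.

Definition b (n k : nat) : nat :=
  width (iter k ideal_poset (discrete n : finPOrderType _)).

(* Main.v *)
Require Import Defs.
From HB Require Import structures.
From mathcomp Require Import all_boot all_order.
From mathcomp Require Import boolp.

(** For a poset [P], let [N(P)] be the digraph on [P] with an arc from [x] to
    [y] whenever [x] is not below [y].  Homomorphisms from the arc graph of [G]
    to [N(P)] exist exactly when homomorphisms from [G] to [N(I(P))] do: send
    [u] to the ideal generated by the colours of the arcs leaving [u]; in the
    other direction, colour [(u, v)] by an element of [f u] outside [f v].
    Iterating, an [n]-colouring of the [k]-th arc graph amounts to a
    homomorphism from [G] to [N(Q)], where [Q] is the [k]-fold ideal poset of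
    the [n]-antichain.  As [G] is symmetric, adjacent vertices then have
    incomparable images, so by Dilworth's theorem such a homomorphism exists
    iff [G] can be coloured with [width Q] colours. *)

Set Implicit Arguments.
Unset Strict Implicit.
Unset Printing Implicit Defensive.

Import Order.TTheory.

(** * Dilworth's theorem for finite posets *)

Section Dilworth.
Context {d : Order.disp_t} (P : finPOrderType d).
Implicit Types (A B : {set P}) (x y z : P).

Lemma antichainP B :
  reflect {in B &, forall x y, (x <= y)%O -> x = y} (antichain B).
Proof.
apply: (iffP idP) => [/'forall_implyP acB x y xB yB xy | acB].
  by have /'forall_implyP/(_ _ yB)/implyP/(_ xy)/eqP := acB x xB.
apply/'forall_implyP => x xB; apply/'forall_implyP => y yB.
by apply/implyP => /(acB _ _ xB yB) ->.
Qed.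

Lemma antichain_sub A B : A \subset B -> antichain B -> antichain A.
Proof.
move=> /subsetP sAB /antichainP acB; apply/antichainP => x y /sAB xB /sAB yB.
exact: acB.
Qed.

(** Relative to a subset, so that the induction for Dilworth's theorem stays inside one poset. *)
Definition width_in A : nat :=
  \max_(B : {set P} | antichain B && (B \subset A)) #|B|.

Lemma leq_width_in A B : antichain B -> B \subset A -> #|B| <= width_in A.
Proof.
move=> acB sBA.
by apply: (leq_bigmax_cond (F := fun B : {set P} => #|B|)); rewrite acB.
Qed.

Lemma width_in_attained A :
  exists B, [/\ antichain B, B \subset A & #|B| = width_in A].
Proof.
have : 0 < #|[pred B : {set P} | antichain B && (B \subset A)]|.
  apply/card_gt0P; exists set0; rewrite inE sub0set andbT.
  by apply/antichainP => x y; rewrite inE.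
case/(eq_bigmax_cond (fun B : {set P} => #|B|)) => B /andP[acB sBA] max_B.
by exists B; split=> //; exact: esym max_B.
Qed.

Lemma width_in_mono A B : A \subset B -> width_in A <= width_in B.
Proof.
move=> sAB; have [C [acC sCA <-]] := width_in_attained A.
exact: leq_width_in acC (subset_trans sCA sAB).
Qed.

Lemma width_inT : width_in setT = width P.
Proof. by apply: eq_bigl => B; rewrite subsetT andbT. Qed.

Lemma exists_maximal A x0 : x0 \in A ->
  exists2 m, m \in A & {in A, forall y, (m <= y)%O -> y = m}.
Proof.
(* An element of [A] with the largest down-set is maximal in [A]. *)
move=> x0A; pose below x := #|[set y | (y <= x)%O]|.
have [m mA m_max] := arg_maxnP below x0A.
exists m => // y yA le_my; apply/eqP; apply: contraTT (m_max y yA) => ne_ym.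
rewrite -ltnNge; apply: proper_card; apply/properP; split.
  by apply/subsetP => z; rewrite !inE => /le_trans; apply.
exists y; rewrite !inE ?lexx //; apply: contraNN ne_ym => le_ym.
by rewrite eq_le le_ym.
Qed.

Definition chain_coloring A (c : P -> nat) (n : nat) : Prop :=
  {in A, forall x, c x < n} /\
  {in A &, forall x y, c x = c y -> (x >=< y)%O}.

(** A chain meets an antichain at most once, so the [n] elements of [B] have distinct colours and
    use up all [n] of them. *)
Lemma chain_coloring_meets A c n B i :
  chain_coloring A c n -> antichain B -> B \subset A -> #|B| = n -> i < n ->
  exists2 x, x \in B & c x = i.
Proof.
move=> [c_lt c_chain] /antichainP acB /subsetP sBA cardB lt_in.
case: n => // n in c_lt c_chain cardB lt_in *.
pose g x : 'I_n.+1 := inord (c x).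
have gE x : x \in B -> g x = c x :> nat by move=> /sBA/c_lt ?; rewrite inordK.
have g_inj : {in B &, injective g}.
  move=> x y xB yB /(congr1 val); rewrite /= !gE // => eq_c.
  have /orP[] := c_chain x y (sBA _ xB) (sBA _ yB) eq_c; first exact: acB.
  by move=> /(acB _ _ yB xB).
have /eqP gB : g @: B == [set: 'I_n.+1].
  by rewrite eqEcard subsetT cardsT card_ord card_in_imset // cardB leqnn.
have : inord i \in g @: B by rewrite gB inE.
case/imsetP => x xB /(congr1 val); rewrite /= gE // inordK // => ->.
by exists x.
Qed.

(* Galvin's proof: remove a maximal element [a], colour the rest with [k]
   chains, and let [X] collect, in each chain, the topmost element lying on an
   antichain of size [k].  Then [X] is an antichain; either [a |: X] is one as
   well, or [a] tops the part of a chain below some [x] in [X], and removing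
   that part together with [a] lowers the width. *)
Theorem dilworth_in A : exists c, chain_coloring A c (width_in A).
Proof.
have [n leAn] := ubnP #|A|; elim: n A leAn => // n IHn A leAn.
have [-> | [x0 x0A]] := set_0Vmem A.
  by exists (fun=> 0); split=> x; rewrite inE.
have [a aA a_max] := exists_maximal x0A.
set A' := A :\ a.
have sA'A : A' \subset A by exact: subsetDl.
have ltA'n : #|A'| < n by move: leAn; rewrite (cardsD1 a A) aA.
have [c colA'] := IHn A' ltA'n.
have [c_lt c_chain] := colA'.
set k := width_in A' in colA' c_lt.
pose good x := [exists B : {set P},
  [&& antichain B, B \subset A', #|B| == k & x \in B]].
have goodI B x : antichain B -> B \subset A' -> #|B| = k -> x \in B -> good x.
  by move=> acB sB cB xB; apply/existsP; exists B; rewrite acB sB cB eqxx.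
pose X := [set x in A' | good x &&
  [forall y in A', (good y && (c y == c x)) ==> (y <= x)%O]].
have XP x : x \in X -> [/\ x \in A', good x &
    {in A', forall y, good y -> c y = c x -> (y <= x)%O}].
  rewrite inE => /and3P[xA' gx /'forall_implyP mx]; split=> // y yA' gy cyx.
  by have /implyP := mx y yA'; rewrite gy cyx eqxx; apply.
have acX : antichain X.
  apply/antichainP => x y /XP[xA' gx mx] /XP[yA' gy my] le_xy.
  (* An antichain of size [k] through [y] meets the chain of [x] in some [z <= x <= y]; hence
     [z = y], and [y] has the colour of [x]. *)
  have /existsP[B /and4P[acB sBA' /eqP cB yB]] := gy.
  have [z zB cz] := chain_coloring_meets colA' acB sBA' cB (c_lt _ xA').
  have le_zx := mx z (subsetP sBA' z zB) (goodI B z acB sBA' cB zB) cz.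
  have zy : z = y by apply: (antichainP _ acB) => //; exact: le_trans le_zx le_xy.
  by apply/le_anti; rewrite le_xy mx // -zy.
have [B0 [acB0 sB0 cB0]] := width_in_attained A'.
have X_meets i : i < k -> exists2 x, x \in X & c x = i.
  move=> lt_ik.
  have [z zB0 cz] := chain_coloring_meets colA' acB0 sB0 cB0 lt_ik.
  have zS : z \in [set y in A' | good y && (c y == i)].
    by rewrite inE (subsetP sB0) // cz eqxx andbT (goodI B0).
  have [m] := exists_maximal zS; rewrite inE => /and3P[mA' gm /eqP cm] m_max.
  exists m => //; rewrite inE mA' gm; apply/'forall_implyP => y yA'.
  apply/implyP => /andP[gy /eqP cy].
  have /orP[] // := c_chain _ _ yA' mA' cy.
  by move=> /m_max ->; rewrite // inE yA' gy cy cm eqxx.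
have le_kX : k <= #|X|.
  rewrite cardE -(size_map c) -[leqLHS](size_iota 0).
  apply: uniq_leq_size (iota_uniq 0 k) _ => i.
  rewrite mem_iota /= => /X_meets[x xX <-].
  by apply: map_f; rewrite mem_enum.
have aA' : a \notin A' by rewrite !inE eqxx.
have aX : a \notin X by rewrite inE (negPf aA').
(* If no element of [X] lies below [a], then [a |: X] is an antichain with more than [k] elements,
   which pays for the new colour [k] given to [a]. *)
have [x /andP[xX le_xa] | noX] := pickP [pred x in X | (x <= a)%O]; last first.
  have acaX : antichain (a |: X).
    apply/antichainP => x y /setU1P[-> | xX] /setU1P[-> | yX] //.
    - by have [yA' _ _] := XP y yX => /(a_max y (subsetP sA'A y yA')).
    - by move=> le_xa; have := noX x; rewrite /= xX le_xa.
    - exact: (antichainP _ acX).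
  have lt_k : k < width_in A.
    apply: leq_trans (leq_width_in acaX _); first by rewrite cardsU1 aX.
    rewrite subUset sub1set aA; apply/subsetP => x /XP[xA' _ _].
    exact: (subsetP sA'A).
  have inA' x : x \in A -> x != a -> x \in A' by rewrite !inE => -> ->.
  exists (fun x => if x == a then k else c x); split=> [x xA | x y xA yA].
    by case: eqVneq => // /(inA' x xA) /c_lt /ltn_trans; apply.
  case: eqVneq => [-> | /(inA' x xA) xA']; case: eqVneq => [-> | /(inA' y yA) yA'].
  - by rewrite comparablexx.
  - by move=> e; have := c_lt _ yA'; rewrite -e ltnn.
  - by move=> e; have := c_lt _ xA'; rewrite e ltnn.
  - exact: c_chain.
have [xA' gx mx] := XP x xX.
pose K := a |: [set z in A' | (c z == c x) && (z <= x)%O].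
have K_chain : {in K &, forall y z, (y >=< z)%O}.
  have le_a z : z \in K -> (z <= a)%O.
    case/setU1P => [-> // |]; rewrite inE => /and3P[_ _ le_zx].
    exact: le_trans le_zx le_xa.
  move=> y z yK zK; have := yK; have := zK.
  case/setU1P => [-> _ | zK']; first by rewrite /Order.comparable le_a.
  case/setU1P => [-> | yK']; first by rewrite /Order.comparable le_a ?orbT.
  move: yK' zK'; rewrite 2!in_set => /and3P[yA' /eqP cy _] /and3P[zA' /eqP cz _].
  by apply: c_chain => //; rewrite cy cz.
set D := A :\: K.
have sDA' : D \subset A' by apply: setDS; rewrite sub1set !inE eqxx.
(* An antichain of size [k] in [D] would meet the chain of [x] in a good element, which is below [x]
   and hence in [K]. *)
have lt_Dk : width_in D < k.
  rewrite ltn_neqAle width_in_mono // andbT; apply/eqP => eq_Dk.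
  have [B [acB sBD]] := width_in_attained D; rewrite eq_Dk => cB.
  have sBA' := subset_trans sBD sDA'.
  have [z zB cz] := chain_coloring_meets colA' acB sBA' cB (c_lt _ xA').
  have zA' := subsetP sBA' z zB.
  have := subsetP sBD z zB; rewrite inE => /andP[/negP zK _].
  apply/zK/setU1P; right; rewrite inE zA' cz eqxx /=.
  exact: mx zA' (goodI B z acB sBA' cB zB) cz.
have [c' [c'_lt c'_chain]] := IHn D (leq_ltn_trans (subset_leq_card sDA') ltA'n).
have le_DA : width_in D < width_in A := leq_trans lt_Dk (width_in_mono sA'A).
have inD y : y \in A -> y \notin K -> y \in D by rewrite [y \in D]inE => -> ->.
(* [width_in D] exceeds every colour used on [D] and is still below [width_in A]. *)
exists (fun y => if y \in K then width_in D else c' y).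
split=> [y yA | y z yA zA].
  by case: ifPn => // /(inD y yA) /c'_lt /ltn_trans; apply.
case: ifPn => [yK | /(inD y yA) yD]; case: ifPn => [zK | /(inD z zA) zD].
- by move=> _; exact: K_chain.
- by move=> e; have := c'_lt _ zD; rewrite -e ltnn.
- by move=> e; have := c'_lt _ yD; rewrite e ltnn.
- exact: c'_chain.
Qed.

Corollary dilworth :
  exists c : P -> 'I_(width P), forall x y, c x = c y -> (x >=< y)%O.
Proof.
have [c [c_lt c_chain]] := dilworth_in setT; rewrite width_inT in c_lt.
exists (fun x => Ordinal (c_lt x (in_setT x))) => x y [].
exact: c_chain.
Qed.

End Dilworth.

(** * Homomorphisms to [N(P)], arc graphs and ideals *)

Definition nle_hom (G : digraph) {d} (P : finPOrderType d) : Prop :=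
  exists f : G -> P, forall u v, is_arc u v -> ~~ (f u <= f v)%O.

Lemma is_idealP {d} (P : finPOrderType d) (A : {set P}) :
  reflect (forall x y, x \in A -> (y <= x)%O -> y \in A) (is_ideal A).
Proof.
apply: (iffP idP) => [/'forall_implyP idA x y xA le_yx | idA].
  by have /forallP/(_ y)/implyP := idA x xA; apply.
apply/'forall_implyP => x xA; apply/forallP => y; apply/implyP.
exact: idA xA.
Qed.

Lemma nle_hom_arc_graph (G : digraph) {d} (P : finPOrderType d) :
  nle_hom (arc_graph G) P <-> nle_hom G (ideal_poset P).
Proof.
split=> [[c c_hom] | [f f_hom]].
  pose F u := [set p | `[< exists2 e : arc_graph G,
                             (sval e).1 = u & (p <= c e)%O >]].
  have F_ideal u : is_ideal (F u).
    apply/is_idealP => p q; rewrite !inE => /asboolP[e eu le_p] le_qp.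
    by apply/asboolP; exists e => //; exact: le_trans le_qp le_p.
  exists (fun u => Ideal (F_ideal u)) => u v uv.
  (* The colour of [(u, v)] lies in [F u]; if it lay in [F v], it would be below the colour of an
     arc following [(u, v)]. *)
  pose e : arc_graph G := exist _ (u, v) uv.
  apply/subsetPn; exists (c e); rewrite /= inE; first by apply/asboolP; exists e.
  apply/negP => /asboolP[e' e'v]; apply/negP/c_hom.
  exact/asboolP.
have /choice[c cP] : forall e : arc_graph G, exists p : P,
    (p \in ideal_set (f (sval e).1)) && (p \notin ideal_set (f (sval e).2)).
  move=> [[u v] /= uv]; have /subsetPn[p pu pv] := f_hom u v uv.
  by exists p; rewrite pu pv.
(* At the vertex shared by [e1] and [e2], the ideal contains [c e2] but not [c e1]. *)
exists c => e1 e2 /asboolP e12; apply/negP => le_c.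
have /andP[_ /negP[]] := cP e1; have /andP[c2 _] := cP e2.
rewrite e12; case: (f _) c2 => A idA /= c2.
exact: (is_idealP _ idA) c2 le_c.
Qed.

(** Each step trades the outermost arc graph for an innermost ideal poset, so the induction needs
    [P] general. *)
Lemma nle_hom_iter (G : digraph) {d} (P : finPOrderType d) k :
  nle_hom (iter k arc_graph G) P <-> nle_hom G (iter k (@ideal_poset d) P).
Proof.
elim: k P => // k IHk P.
by rewrite iterS nle_hom_arc_graph IHk -iterSr.
Qed.

Lemma nle_hom_discrete (G : digraph) n :
  nle_hom G (discrete n : finPOrderType _) <-> colorable G n.
Proof.
by split=> -[c c_col]; exists c => u v /c_col; [move/eqP | move=> neq; apply/eqP].
Qed.

Lemma colorableW (G : digraph) m n : m <= n -> colorable G m -> colorable G n.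
Proof.
move=> le_mn [c c_col]; exists (widen_ord le_mn \o c) => u v /c_col neq.
by move=> /(congr1 val) /= /val_inj.
Qed.

Lemma nle_hom_symmetric (G : digraph) {d} (P : finPOrderType d) :
  symmetric (@is_arc G) -> nle_hom G P <-> colorable G (width P).
Proof.
move=> symG; split=> [[f f_hom] | [c c_col]].
  have [c c_chain] := dilworth P.
  exists (c \o f) => u v uv /c_chain /orP[]; apply/negP/f_hom => //.
  by rewrite symG.
(* Conversely, colours are sent injectively into a maximum antichain, where distinct elements are
   incomparable. *)
have [B [acB _ cB]] := width_in_attained [set: P]; rewrite width_inT in cB.
pose g (i : 'I_(width P)) := enum_val (cast_ord (esym cB) i).
exists (g \o c) => u v uv; apply/negP.
move/(antichainP _ acB _ _ (enum_valP _) (enum_valP _))/enum_val_inj/cast_ord_inj.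
exact: c_col.
Qed.

Lemma onat_le_chromatic_number (G : digraph) n :
  onat_le (chromatic_number G) n <-> colorable G n.
Proof.
rewrite /chromatic_number /min_nat; case: pselect => [exP | noP] /=.
  case: ex_minnP => m /asboolP col_m m_min; split=> [le_mn | col_n].
    exact: colorableW col_m.
  by apply: m_min; apply/asboolP.
by split=> // col_n; case: noP; exists n; apply/asboolP.
Qed.

Theorem theorem1p3 (G : digraph) (k : nat)
    (symG : symmetric (@is_arc G)) (k_ge1 : 1 <= k) :
  chromatic_number (iter k arc_graph G) =
    min_nat (fun n => onat_le (chromatic_number G) (b n k)).
Proof.
(* Both minima range over the same set of [n], which also settles the case where it is empty. *)
congr min_nat; apply/funext => n; apply/propext.
rewrite onat_le_chromatic_number -nle_hom_discrete nle_hom_iter.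
exact: nle_hom_symmetric.
Qed.
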